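(* For $1\le i\le N$ let $\sigma(A_i+\beta_{ii}H_iC_i)=\{\mu_i^1,\dots,\mu_i^{q_i}\}$ be the set of distinct eigenvalues of $A_i+\beta_{ii}H_iC_i$, let $\gamma_{ij}$ be the geometric multiplicity of $\mu_i^j$ as an eigenvalue of $A_i+\beta_{ii}H_iC_i$, and let $\zeta_{ij}^k\in\mathbb{C}^{1\times n_i}$, $1\le k\le\gamma_{ij}$, be (linearly independent) left eigenvectors of $A_i+\beta_{ii}H_iC_i$ corresponding to $\mu_i^j$. Suppose that for all $i,l\in\{1,\dots,N\}$ with $\beta_{il}\neq 0$: - if $i>l$, then $H_iC_l=0$; - if $i<l$, then $\zeta_{ij}^kH_iC_l=0$ for all $1\le j\le q_i$ and $1\le k\le\gamma_{ij}$. Then the networked system $\dot X=\mathcal{A}X+\mathcal{B}U$ is controllable if and only if both of the following hold: (i) $(A_i+\beta_{ii}H_iC_i,\,B_i)$ is a controllable pair for every $1\le i\le N$; (ii) each node is under external control, i.e. $\delta_i\ne0$ for all $i=1,\dots,N$.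
   Context: A networked system with $N$ nodes is given by data $A_i\in\mathbb{R}^{n_i\times n_i}$, $B_i\in\mathbb{R}^{n_i\times p_i}$, $C_i\in\mathbb{R}^{m\times n_i}$, $H_i\in\mathbb{R}^{n_i\times m}$ (inner-coupling matrices), $\delta_i\in\{0,1\}$ for $1\le i\le N$ ($\delta_i=1$ if node $i$ has an external control input, $0$ otherwise), and real numbers $\beta_{ij}$, $1\le i,j\le N$, where $\beta_{ij}\ne0$ if and only if there is an edge from node $j$ to node $i$. The node dynamics are $\dot x_i=A_ix_i+\sum_{j=1}^N\beta_{ij}H_iC_jx_j+\delta_iB_iu_i$, $y_i=C_ix_i$. Put $\mathcal{N}=\sum_{i=1}^Nn_i$. In compact form the networked system is $\dot X=\mathcal{A}X+\mathcal{B}U$, $Y=\mathcal{C}X$, where $\mathcal{A}=\mathrm{blockdiag}\{A_1,\dots,A_N\}+(\beta_{ij}H_iC_j)_{i,j=1}^N\in\mathbb{R}^{\mathcal{N}\times\mathcal{N}}$, $\mathcal{B}=\mathrm{blockdiag}\{\delta_1B_1,\dots,\delta_NB_N\}$, $\mathcal{C}=\mathrm{blockdiag}\{C_1,\dots,C_N\}$. A linear system $\dot x=Ax+Bu$ with $A\in\mathbb{R}^{n\times n}$ (equivalently the pair $(A,B)$) is controllable if for any $x_0,x_f\in\mathbb{R}^n$ and any final time $t_f>t_0$ there is an admissible control $u$ on $[t_0,t_f]$ steering $x(t_0)=x_0$ to $x(t_f)=x_f$; equivalently $\mathrm{rank}[B\,|\,AB\,|\cdots|\,A^{n-1}B]=n$.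 $\sigma(M)$ denotes the set of (complex) eigenvalues of $M$. A left eigenvector of a square matrix $M$ for the eigenvalue $\mu$ is a nonzero row vector $v$ with $vM=\mu v$. *)

(* Defs.v *)
From HB Require Import structures.
From mathcomp Require Import all_boot all_order all_algebra.
From mathcomp Require Import complex.
From mathcomp Require Import all_classical all_reals all_analysis.

Set Implicit Arguments.
Unset Strict Implicit.
Unset Printing Implicit Defensive.

Import Order.TTheory GRing.Theory Num.Theory.
Import numFieldNormedType.Exports.

Local Open Scope classical_set_scope.
Local Open Scope ring_scope.

Section LinearControl.
Context {R : realType} {n p : nat}.

Definition admissible_control (t0 tf : R) (u : R -> 'cV[R]_p) : Prop :=
  forall k, (@lebesgue_measure R).-integrable `[t0, tf]
              (EFin \o (fun s => u s k 0)).

(* Caratheodory solution of x' = A x + B u: for an integrable input, the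
   continuous solutions of the integral equation are exactly the absolutely
   continuous x satisfying the differential equation almost everywhere.  The
   integrand is integrable whenever u is admissible, since x is continuous. *)
Definition is_trajectory (A : 'M[R]_n) (B : 'M[R]_(n, p)) (t0 tf : R)
    (u : R -> 'cV[R]_p) (x : R -> 'cV[R]_n) : Prop :=
  (forall k, {within `[t0, tf], continuous (fun s => x s k 0)}) /\
  (forall t k, t0 <= t <= tf ->
     x t k 0 = x t0 k 0 +
       Rintegral (@lebesgue_measure R) `[t0, t]
         (fun s => (A *m x s + B *m u s) k 0)).

Definition controllable (A : 'M[R]_n) (B : 'M[R]_(n, p)) : Prop :=
  forall (x0 xf : 'cV[R]_n) (t0 tf : R), t0 < tf ->
  exists (u : R -> 'cV[R]_p) (x : R -> 'cV[R]_n),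
    [/\ admissible_control t0 tf u, is_trajectory A B t0 tf u x,
        x t0 = x0 & x tf = xf].

End LinearControl.

(* The library's mxdiag only accepts square blocks.  On the diagonal i == j the
   dimensions agree, so conform_mx 0 (B i) is B i. *)
Definition mxblockdiag (R : nmodType) (N : nat) (n p : 'I_N -> nat)
    (B : forall i, 'M[R]_(n i, p i)) : 'M[R]_(\sum_i n i, \sum_i p i) :=
  \mxblock_(i, j) (if i == j then conform_mx 0 (B i) else 0).

Section NetworkedSystem.
Context {R : realType} {N m : nat} {n p : 'I_N -> nat}.

Definition node_mx (A : forall i, 'M[R]_(n i)) (C : forall i, 'M[R]_(m, n i))
    (H : forall i, 'M[R]_(n i, m)) (beta : 'I_N -> 'I_N -> R) (i : 'I_N) :
    'M[R]_(n i) :=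
  A i + beta i i *: (H i *m C i).

Definition network_state_mx (A : forall i, 'M[R]_(n i))
    (C : forall i, 'M[R]_(m, n i)) (H : forall i, 'M[R]_(n i, m))
    (beta : 'I_N -> 'I_N -> R) : 'M[R]_(\sum_i n i) :=
  \mxdiag_i A i + \mxblock_(i, j) (beta i j *: (H i *m C j)).

Definition network_input_mx (B : forall i, 'M[R]_(n i, p i))
    (delta : 'I_N -> bool) : 'M[R]_(\sum_i n i, \sum_i p i) :=
  mxblockdiag (fun i => (delta i)%:R *: B i).

End NetworkedSystem.

Definition left_eigenvector (F : fieldType) (n : nat) (M : 'M[F]_n) (a : F)
    (v : 'rV[F]_n) : Prop :=
  v != 0 /\ v *m M = a *: v.

Definition complexify {R : realType} {m n : nat} (M : 'M[R]_(m, n)) :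
    'M[R[i]]_(m, n) :=
  map_mx (real_complex R) M.

(* Main.v *)
Require Import Defs.
From HB Require Import structures.
From mathcomp Require Import all_boot all_order all_algebra.
From mathcomp Require Import complex.
From mathcomp Require Import all_classical all_reals all_analysis.
From mathcomp Require Import ring.

Set Implicit Arguments.
Unset Strict Implicit.
Unset Printing Implicit Defensive.

Import Order.TTheory GRing.Theory Num.Theory.
Local Open Scope ring_scope.

(** The proof rests on the Hautus test: (A, B) is controllable if and only if no
complex left eigenvector of A is annihilated by B.  Since the lower blocks
H_i C_l of the network matrix vanish, that matrix is block upper triangular
with diagonal blocks M_i = A_i + beta_ii H_i C_i.

If v is a left eigenvector of the network matrix annihilated by the inputs,
its first nonzero block v_i only meets the diagonal block M_i in column i, so
it is a left eigenvector of M_i annihilated by delta_i B_i ([nodes_network]).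
Conversely a left eigenvector z of M_i is a combination of the given zeta, so
it is annihilated by the upper blocks H_i C_l too; hence z, padded with zeros,
is a left eigenvector of the whole network ([network_nodes]).  So the network is
controllable if and only if every (M_i, delta_i B_i) passes the Hautus test, and
as M_i has at least one left eigenvector, delta_i = 0 is impossible.

The Hautus test for trajectories ([hautus]) has three ingredients.
- Necessity.  The real and imaginary parts of a bad eigenvector are the rows of
  a matrix V with V A = S V and V B = 0.  Then z = V x satisfies z' = S z
  whatever the input, so z stays 0 when it starts at 0, which contradicts the
  freedom of choice of the final state.  As the final time may be chosen, a
  short interval suffices: on it the integral equation is a contraction
  ([trajectory_vanishes]).
- Linear algebra.  Either the blocks A^k B span the state space, in the form
  sum_k A^k B L_k = 1, or the row vectors annihilating them all form a nonzero
  A-invariant space, which contains a complex eigenvector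
  ([kalman_or_invariant], [invariant_eigenvector]).
- Sufficiency.  From sum_k A^k B L_k = 1 one builds a polynomial trajectory.  A
  polynomial curve X joins the two states and satisfies the uncontrolled
  equation up to a defect that vanishes to high order at both end times
  ([interpolate_drift]).  The defect is f = sum_k A^k B (L_k f), and modulo the
  image of D - A, where D is differentiation, A^k B g equals B (D^k g), which an
  input produces.  The correction to X involves only derivatives of f, so it
  vanishes at the end times ([absorb_iterated_input],
  [polynomial_trajectory]). *)

Local Notation cmx := (map_mx polyC).
Local Notation "''D' X" := (map_mx (@deriv _) X) (at level 10, X at level 9) : ring_scope.

(** * Polynomial trajectories *)

Section PolynomialVectors.
Context {R : realFieldType}.
Implicit Types (n p : nat).

Lemma derivmxZ n p (f : {poly R}) (X : 'M[{poly R}]_(n, p)) :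
  'D (f *: X) = f^`() *: X + f *: 'D X.
Proof. by apply/matrixP => i j; rewrite !mxE derivM. Qed.

Lemma derivmx_mull n p k (A : 'M[R]_(n, p)) (X : 'M[{poly R}]_(p, k)) :
  'D (cmx A *m X) = cmx A *m 'D X.
Proof.
apply/matrixP => i j; rewrite !mxE raddf_sum; apply: eq_bigr => l _ /=.
by rewrite !mxE derivM derivC mul0r add0r.
Qed.

(** A forcing term A^k B g can be replaced by the input D^k g at the price of a
change of state: D^k - A^k is divisible by D - A.  The step from k to k + 1
takes Y to D Y + A^k B g; each derivative costs one factor q, hence the
exponent M + k on the right and M on the left. *)
Lemma absorb_iterated_input n p (A : 'M[R]_n) (B : 'M[R]_(n, p)) (q : {poly R}) k M
    (G : 'cV[{poly R}]_p) :
  exists (Y : 'cV[{poly R}]_n) (U : 'cV[{poly R}]_p),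
    'D (q ^+ M *: Y) = cmx A *m (q ^+ M *: Y) + cmx B *m U
                   - cmx (iter k (mulmx A) B) *m (q ^+ (M + k) *: G).
Proof.
elim: k M => [|k IH] M.
  exists 0, (q ^+ M *: G).
  by rewrite scaler0 raddf0 mulmx0 add0r addn0 subrr.
have [Y [U e]] := IH M.+1.
(* Z is D (q^(M+1) Y) + A^k B q^(M+1+k) G with the factor q^M taken out *)
exists (M.+1%:R *: (q^`() *: Y) + q *: 'D Y + q ^+ k.+1 *: (cmx (iter k (mulmx A) B) *m G)), ('D U).
set Z := _ + _ *: _ : 'cV__.
have -> : q ^+ M *: Z = 'D (q ^+ M.+1 *: Y) + cmx (iter k (mulmx A) B) *m (q ^+ (M.+1 + k) *: G).
  rewrite derivmxZ -scalemxAr deriv_exp /= /Z !scalerDr !scalerA.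
  rewrite addSnnS exprD exprSr; congr (_ *: _ + _ + _).
    by rewrite -mulr_natl mulrC mulrA; ring.
  by rewrite exprSr.
rewrite [in LHS]e subrK raddfD /= !derivmx_mull map_mxM /= mulmxDr addSnnS.
by rewrite mulmxA [X in _ = X - _]addrAC addrK.
Qed.

(** Start from the line segment and raise the order of vanishing of the defect one
by one.  Subtracting q^(M+1) H from the curve changes the defect q^M G,
modulo q^(M+1), by - (M + 1) q^M q' H, so H should be G / ((M + 1) q') modulo q.
This inverse exists because q has simple roots; explicitly
q'^2 = 4 q + (tf - t0)^2. *)
Lemma interpolate_drift n (A : 'M[R]_n) (x0 xf : 'cV[R]_n) (t0 tf : R) M :
  t0 != tf ->
  exists X G : 'cV[{poly R}]_n,
   [/\ map_mx (horner^~ t0) X = x0, map_mx (horner^~ tf) X = xf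
     & 'D X = cmx A *m X + (('X - t0%:P) * ('X - tf%:P)) ^+ M *: G].
Proof.
move=> t0f; have d0 : tf - t0 != 0 by rewrite subr_eq0 eq_sym.
elim: M => [|M [X [G [X0 Xf dX]]]].
  set X := cmx x0 + ('X - t0%:P) *: cmx ((tf - t0)^-1 *: (xf - x0)).
  exists X, ('D X - cmx A *m X); split; last by rewrite expr0 scale1r addrC subrK.
    by apply/matrixP => i j; rewrite !mxE hornerD hornerM !hornerC hornerXsubC; ring.
  by apply/matrixP => i j; rewrite !mxE hornerD hornerM !hornerC hornerXsubC; field.
set q := (_ * _)%R in dX *.
have [c e2] : exists c : {poly R}, c * ((tf - t0) ^+ 2)%:P = 1.
  by exists ((tf - t0) ^- 2)%:P; rewrite -polyCM mulVf // expf_neq0.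
have [m e3] : exists m : {poly R}, m * M.+1%:R = 1.
  by exists (M.+1%:R^-1)%:P; rewrite -polyC_natr -polyCM mulVf ?pnatr_eq0.
pose H := (m * c * q^`()) *: G.
exists (X - q ^+ M.+1 *: H).
exists ((- (4%:R * c)) *: G - 'D H + cmx A *m H).
have qa t : t \in [:: t0; tf] -> q.[t] = 0.
  by rewrite !inE /q hornerM !hornerXsubC => /orP[] /eqP ->; rewrite subrr ?mul0r ?mulr0.
have ev t : t \in [:: t0; tf] ->
    map_mx (horner^~ t) (X - q ^+ M.+1 *: H) = map_mx (horner^~ t) X.
  by move=> /qa q0; apply/matrixP => i j; rewrite !mxE hornerD hornerN hornerM horner_exp q0 expr0n mul0r oppr0 addr0.
split; rewrite ?ev ?X0 ?Xf ?inE ?eqxx ?orbT //.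
rewrite raddfB /= derivmxZ dX deriv_exp /= mulmxBr -!scalemxAr.
(* the explicit inverse of q' modulo q *)
have e1 : q^`() ^+ 2 = 4%:R * q + ((tf - t0) ^+ 2)%:P.
  rewrite /q derivM !derivXsubC rmorphXn rmorphB /=; ring.
have e4 : q^`() *: H = (m * (4%:R * (c * q) + 1)) *: G.
  rewrite /H scalerA; congr (_ *: _).
  have -> : q^`() * (m * c * q^`()) = m * c * q^`() ^+ 2 by ring.
  by rewrite e1 -e2; ring.
move: (cmx A *m H) (cmx A *m X) ('D H) e4 => AH AX DH e4.
have -> : (q^`() * q ^+ M *+ M.+1) *: H = (q ^+ M * (4%:R * (c * q) + 1)) *: G.
  have -> : q^`() * q ^+ M *+ M.+1 = q ^+ M * M.+1%:R * q^`().
    by rewrite -mulr_natr; ring.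
  rewrite -scalerA e4 scalerA; congr (_ *: _).
  move: (_ * (c * q) + 1) => z.
  have -> : q ^+ M * M.+1%:R * (m * z) = (m * M.+1%:R) * (q ^+ M * z) by ring.
  by rewrite e3 mul1r.
rewrite exprSr.
by apply/matrixP => i j; rewrite !mxE; ring.
Qed.

(** Split the defect F of an interpolating curve as sum_k A^k B L_k F and absorb
each term separately. *)
Lemma polynomial_trajectory n p N (A : 'M[R]_n) (B : 'M[R]_(n, p))
    (L : 'I_N -> 'M[R]_(p, n)) (x0 xf : 'cV[R]_n) (t0 tf : R) :
  \sum_(k < N) iter k (mulmx A) B *m L k = 1%:M -> t0 != tf ->
  exists (X : 'cV[{poly R}]_n) (U : 'cV[{poly R}]_p),
   [/\ map_mx (horner^~ t0) X = x0, map_mx (horner^~ tf) X = xf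
     & 'D X = cmx A *m X + cmx B *m U].
Proof.
move=> kalman t0f.
have [X [G [X0 Xf dX]]] := interpolate_drift A x0 xf N t0f.
set q := (_ * _)%R in dX.
(* The exponent N - k is positive, so the k-th correction still vanishes at both
   end times, while its forcing term carries the factor q^N of the defect. *)
pose Gk (k : 'I_N) := absorb_iterated_input A B q k (N - k) (cmx (L k) *m G).
have [Y hY] := fin_all_exists Gk.
have [U dY] := fin_all_exists hY.
exists (X + \sum_(k < N) q ^+ (N - k) *: Y k), (\sum_k U k).
have ev t : t \in [:: t0; tf] ->
    map_mx (horner^~ t) (X + \sum_(k < N) q ^+ (N - k) *: Y k) = map_mx (horner^~ t) X.
  move=> ht; have q0 : q.[t] = 0.
    move: ht.
    by rewrite !inE /q hornerM !hornerXsubC => /orP[] /eqP ->; rewrite subrr ?mul0r ?mulr0.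
  apply/matrixP => i j; rewrite !mxE summxE hornerD horner_sum big1 ?addr0 //.
  move=> k _; rewrite mxE hornerM horner_exp q0 expr0n subn_eq0 leqNgt ltn_ord.
  by rewrite mul0r.
split; rewrite ?ev ?X0 ?Xf ?inE ?eqxx ?orbT //.
rewrite raddfD raddf_sum /= dX; under eq_bigr do rewrite dY.
rewrite sumrB big_split /= -!mulmx_sumr mulmxDr.
have -> : \sum_(k < N) cmx (iter k (mulmx A) B) *m
            (q ^+ (N - k + k) *: (cmx (L k) *m G)) = q ^+ N *: G.
  under eq_bigr => k _ do
    rewrite subnK 1?ltnW // -scalemxAr mulmxA -map_mxM /=.
  rewrite -scaler_sumr -mulmx_suml; congr (_ *: _).
  by rewrite -raddf_sum kalman /= map_mx1 mul1mx.
set a := cmx A *m _; set b := q ^+ N *: _; set c := cmx A *m _.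
by rewrite addrACA subrr addr0 addrA.
Qed.
End PolynomialVectors.

(** * The Kalman condition implies controllability *)

Section RankConditionSuffices.
Import numFieldNormedType.Exports.
Local Open Scope classical_set_scope.
Context {R : realType}.
Local Notation mu := (@lebesgue_measure R).

Lemma horner_FTC (P : {poly R}) (a b : R) : a <= b ->
  P.[b] = P.[a] + \int[mu]_(x in `[a, b]) P^`().[x].
Proof.
rewrite le_eqVlt => /orP[/eqP<-|ab].
  by rewrite set_itv1 Rintegral_set1 addr0.
rewrite /Rintegral (@continuous_FTC2 _ _ (horner P)) //=.
- by rewrite addrCA subrr addr0.
- apply: continuous_subspaceT => x; exact: continuous_horner.
- split; first by move=> x _; exact: derivable_horner.
  + exact/cvg_at_right_filter/continuous_horner.
  + exact/cvg_at_left_filter/continuous_horner.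
- by move=> x _; rewrite -derivE.
Qed.

Lemma continuous_horner_mx n p (X : 'M[{poly R}]_(n, p)) i j (D : set R) :
  {within D, continuous (fun t => map_mx (horner^~ t) X i j)}.
Proof.
apply: continuous_subspaceT.
rewrite (_ : (fun t => _) = horner (X i j)); first exact: continuous_horner.
by apply/funext => t; rewrite mxE.
Qed.

Lemma kalman_controllable n p N (A : 'M[R]_n) (B : 'M[R]_(n, p))
    (L : 'I_N -> 'M[R]_(p, n)) :
  \sum_(k < N) iter k (mulmx A) B *m L k = 1%:M -> controllable A B.
Proof.
move=> kalman x0 xf t0 tf t0f.
have [X [U [X0 Xf dX]]] := polynomial_trajectory x0 xf kalman (negbT (lt_eqF t0f)).
exists (fun t => map_mx (horner^~ t) U), (fun t => map_mx (horner^~ t) X).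
split=> //.
  move=> k; apply: continuous_compact_integrable; first exact: segment_compact.
  exact: continuous_horner_mx.
split=> [k|t k /andP[t0t _]]; first exact: continuous_horner_mx.
rewrite [LHS]mxE [X in X + _]mxE (horner_FTC _ t0t); congr (_ + _).
apply: eq_Rintegral => s _.
transitivity ('D X k 0).[s]; first by rewrite mxE.
rewrite dX !mxE hornerD !horner_sum.
by congr (_ + _); apply: eq_bigr => j _; rewrite !mxE hornerM hornerC.
Qed.
End RankConditionSuffices.

(** * Invariant functionals obstruct controllability *)

Section Necessity.
Import numFieldNormedType.Exports.
Local Open Scope classical_set_scope.
Context {R : realType}.
Local Notation mu := (@lebesgue_measure R).

Lemma integrable_linear_combination (I : finType) (D : set R) (c : I -> R)
    (g : I -> R -> R) :
  measurable D -> (forall i, mu.-integrable D (EFin \o g i)) ->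
  mu.-integrable D (EFin \o (fun s => \sum_i c i * g i s)).
Proof.
move=> mD ig.
have -> : EFin \o (fun s => \sum_i c i * g i s)
        = (fun s => \sum_i ((c i)%:E * (EFin \o g i) s))%E.
  by apply/funext => s /=; rewrite -sumEFin.
by apply: integrable_sum => // i _; exact: integrableZl.
Qed.

Lemma Rintegral_linear_combination (I : finType) (D : set R) (c : I -> R)
    (g : I -> R -> R) :
  measurable D -> (forall i, mu.-integrable D (EFin \o g i)) ->
  \int[mu]_(s in D) (\sum_i c i * g i s) = \sum_i c i * \int[mu]_(s in D) g i s.
Proof.
move=> mD ig; rewrite {1}/Rintegral.
transitivity (fine (\int[mu]_(s in D)
    (\sum_i (c i)%:E * (EFin \o g i) s))%E).
  congr fine; apply: eq_integral => s _.
  by rewrite -sumEFin; apply: eq_bigr => i _; rewrite EFinM.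
rewrite integral_sum //; last by move=> i; exact: integrableZl.
transitivity (fine (\sum_i (c i * \int[mu]_(s in D) g i s)%:E)%E); last first.
  by rewrite sumEFin.
congr fine; apply: eq_bigr => i _; rewrite integralZl // EFinM.
congr (_ * _)%E; rewrite /Rintegral fineK //.
exact: integrable_fin_num (ig i).
Qed.

Lemma le_normr_Rintegral_bounded (f : R -> R) (a b M : R) : a <= b ->
  mu.-integrable `[a, b] (EFin \o f) ->
  (forall s, s \in `[a, b] -> `|f s| <= M) ->
  `|\int[mu]_(s in `[a, b]) f s| <= M * (b - a).
Proof.
move=> ab intf fM.
apply: (le_trans (le_normr_Rintegral _ intf)) => //.
have -> : M * (b - a) = \int[mu]_(s in `[a, b]) M.
  rewrite Rintegral_cst //=; congr (_ * _).
  rewrite lebesgue_measure_itv /= lte_fin; case: ltP => //= ba.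
  by apply/eqP; rewrite subr_eq0 eq_le ab ba.
apply: le_Rintegral => //.
- exact: integrable_norm.
- by apply: continuous_compact_integrable; [exact: segment_compact|exact: cst_continuous].
- by move=> s sab; apply: fM; exact/mem_set.
Qed.

(** On an interval so short that the operator z |-> int S z is a contraction for
the supremum norm, z = V x can only be 0. *)
Lemma trajectory_vanishes n p k (A : 'M[R]_n) (B : 'M[R]_(n, p))
    (V : 'M[R]_(k, n)) (S : 'M[R]_k) (t0 tf : R)
    (u : R -> 'cV[R]_p) (x : R -> 'cV[R]_n) :
  V *m A = S *m V -> V *m B = 0 ->
  t0 <= tf -> (\sum_i \sum_j `|S i j|) * (tf - t0) < 1 ->
  admissible_control t0 tf u -> is_trajectory A B t0 tf u x ->
  x t0 = 0 -> V *m x tf = 0.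
Proof.
move=> VA VB t0f small admu [cx tx] x0.
pose z (i : 'I_k) (t : R) : R := (V *m x t) i 0.
have itv_sub t : t <= tf -> `[t0, t] `<=` `[t0, tf].
  by move=> ttf s /=; rewrite !in_itv /= => /andP[-> /le_trans]; exact.
have ix t j : t <= tf -> mu.-integrable `[t0, t] (EFin \o (fun s => x s j 0)).
  move=> ttf.
  have : mu.-integrable `[t0, tf] (EFin \o (fun s => x s j 0)).
    by apply: continuous_compact_integrable => //; exact: segment_compact.
  by apply: integrableS => //; exact: itv_sub.
have iu t j : t <= tf -> mu.-integrable `[t0, t] (EFin \o (fun s => u s j 0)).
  by move=> ttf; apply: integrableS (admu j) => //; exact: itv_sub.
have ig t j : t <= tf -> mu.-integrable `[t0, t]
    (EFin \o (fun s => (A *m x s + B *m u s) j 0)).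
  move=> ttf.
  have -> : EFin \o (fun s => (A *m x s + B *m u s) j 0) =
     ((EFin \o (fun s => (\sum_l A j l * x s l 0)%R)) \+
      (EFin \o (fun s => (\sum_l B j l * u s l 0)%R)))%E.
    by apply/funext => s /=; rewrite !mxE.
  by apply: integrableD => //; apply: integrable_linear_combination => // l;
    [exact: ix|exact: iu].
have iz t i : t <= tf -> mu.-integrable `[t0, t] (EFin \o z i).
  move=> ttf.
  have -> : z i = fun s => \sum_j V i j * x s j 0 by apply/funext => s; rewrite /z mxE.
  by apply: integrable_linear_combination => // l; exact: ix.
have zE i t : t0 <= t <= tf ->
    z i t = \int[mu]_(s in `[t0, t]) (\sum_l S i l * z l s).
  move=> t0tf; have [_ ttf] := andP t0tf.
  have -> : z i t = \sum_j V i j *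
      \int[mu]_(s in `[t0, t]) (A *m x s + B *m u s) j 0.
    rewrite /z mxE; apply: eq_bigr => j _.
    by rewrite tx // x0 mxE add0r.
  rewrite -Rintegral_linear_combination //; last by move=> j; exact: ig.
  apply: eq_Rintegral => s _.
  transitivity ((V *m (A *m x s + B *m u s)) i 0); first by rewrite mxE.
  by rewrite mulmxDr !mulmxA VA VB mul0mx addr0 -mulmxA mxE.
pose w t := \sum_i `|z i t|.
have cz i : {within `[t0, tf], continuous (z i)}.
  have -> : z i = fun s => \sum_j V i j * x s j 0 by apply/funext => s; rewrite /z mxE.
  apply: continuous_big; [exact: add_continuous|move=> j _ t; apply: cvgMl_tmp; exact: cx].
have cw : {within `[t0, tf], continuous w}.
  apply: continuous_big; [exact: add_continuous|move=> j _ t; apply: cvg_norm; exact: cz].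
have [c cin cmax] := EVT_max t0f cw.
have [t0c ctf] : t0 <= c /\ c <= tf by move: cin; rewrite in_itv /= => /andP.
have w0 t : 0 <= w t by apply: sumr_ge0.
(* at a maximum of w the integral equation bounds w by a multiple of itself *)
have bound : w c <= (\sum_i \sum_j `|S i j|) * w c * (tf - t0).
  rewrite {1}/w !mulr_suml; apply: ler_sum => i _.
  rewrite zE ?t0c //.
  apply: le_trans (_ : ((\sum_j `|S i j|) * w c) * (c - t0) <= _); last first.
    by rewrite ler_wpM2l ?lerB // mulr_ge0 // sumr_ge0.
  apply: le_normr_Rintegral_bounded => //.
    by apply: integrable_linear_combination => // l; exact: iz.
  move=> s; rewrite inE /= in_itv /= => /andP[t0s sc].
  apply: (le_trans (ler_norm_sum _ _ _)); rewrite mulr_suml.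
  apply: ler_sum => l _; rewrite normrM ler_wpM2l //.
  apply: le_trans (_ : w s <= _).
    by rewrite /w (bigD1 l) //= lerDl sumr_ge0.
  by apply: cmax; rewrite in_itv /= t0s (le_trans sc).
have wc : w c = 0.
  apply/eqP; rewrite eq_le w0 andbT.
  have : w c * (1 - (\sum_i \sum_j `|S i j|) * (tf - t0)) <= 0.
    by rewrite mulrBr mulr1 subr_le0 mulrCA mulrA.
  by rewrite pmulr_lle0 // subr_gt0.
apply/colP => i; rewrite [RHS]mxE; apply/eqP; rewrite -normr_le0 -wc.
apply: (@le_trans _ _ (w tf)); last by apply: cmax; rewrite in_itv /= t0f lexx.
by rewrite /w (bigD1 i) //= lerDl sumr_ge0.
Qed.

Lemma controllable_left_invariant n p k (A : 'M[R]_n) (B : 'M[R]_(n, p))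
    (V : 'M[R]_(k, n)) (S : 'M[R]_k) :
  controllable A B -> V *m A = S *m V -> V *m B = 0 -> V = 0.
Proof.
move=> ctrl VA VB.
pose K := \sum_i \sum_j `|S i j|.
have K0 : 0 <= K by do 2!apply: sumr_ge0 => ? _.
(* a final time at which the contraction bound K h < 1 holds *)
have h0 : 0 < (1 + K)^-1 by rewrite invr_gt0 ltr_pwDl.
suff Vx (y : 'cV[R]_n) : V *m y = 0.
  apply/matrixP => i j; rewrite -[V]mulmx1.
  transitivity ((V *m col j 1%:M) i 0); last by rewrite Vx !mxE.
  by rewrite [LHS]mxE [RHS]mxE; apply: eq_bigr => l _; rewrite [col _ _ _ _]mxE.
have [u [x [admu tx x0 <-]]] := ctrl 0 y 0 _ h0.
apply: (trajectory_vanishes VA VB (ltW h0) _ admu tx x0).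
by rewrite subr0 ltr_pdivrMr ?mul1r ?ltrDr // ltr_pwDl.
Qed.
End Necessity.

(** * The Hautus test *)

Section Hautus.
Context {R : realType}.

(** Stated on the blocks A^k B, so that it also makes sense for n = 0, where
Cayley_Hamilton does not apply. *)
Lemma Cayley_Hamilton_iter (F : fieldType) n p (A : 'M[F]_n) (B : 'M[F]_(n, p)) :
  exists c : 'I_n -> F,
    iter n (mulmx A) B = \sum_(k < n) c k *: iter k (mulmx A) B.
Proof.
case: n A B => [|n] A B.
  by exists (fun=> 0); apply/matrixP => -[].
have iterE k : iter k (mulmx A) B = A ^+ k *m B.
  by elim: k => [|k IH]; rewrite ?expr0 ?mul1mx //= IH mulmxA exprS.
have := Cayley_Hamilton A.
rewrite -[char_poly A]coefK size_char_poly poly_def raddf_sum /=.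
rewrite big_ord_recr /= linearZ rmorphXn /= horner_mx_X.
have := char_poly_monic A; rewrite monicE /lead_coef size_char_poly /= => /eqP ->.
rewrite scale1r addrC => /eqP; rewrite addr_eq0 => /eqP An.
exists (fun k => - (char_poly A)`_k).
rewrite -[LHS]/(iter n.+1 (mulmx A) B) (iterE n.+1) An -sumrN mulmx_suml; apply: eq_bigr => k _.
by rewrite iterE linearZ rmorphXn /= horner_mx_X scaleNr mulNmx scalemxAl.
Qed.

(** The dichotomy is whether the block row W = [B, A B, ..., A^(n-1) B] is row
free.  If so, the blocks of a right inverse of W are the L_k; if not, V is a
basis of its left kernel, which is A-invariant by Cayley-Hamilton. *)
Lemma kalman_or_invariant (F : fieldType) n p (A : 'M[F]_n) (B : 'M[F]_(n, p)) :
  (exists L : 'I_n -> 'M[F]_(p, n),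
     \sum_(k < n) iter k (mulmx A) B *m L k = 1%:M) \/
  (exists (r : nat) (V : 'M[F]_(r, n)) (S : 'M[F]_r),
     [/\ (0 < r)%N, row_free V, V *m A = S *m V & V *m B = 0]).
Proof.
pose W := \mxrow_(k < n) iter k (mulmx A) B.
have [/eqP kW|kW] := eqVneq (kermx W) 0.
  left; exists (fun k => submxcol (pinvmx W) k).
  by rewrite -mul_mxrow_mxcol submxcolK mulmxVp // -kermx_eq0.
right; pose V := row_base (kermx W).
have VW k : (k < n)%N -> V *m iter k (mulmx A) B = 0.
  move=> kn; have : V *m W = 0 by apply/sub_kermxP; rewrite eq_row_base.
  move=> /(congr1 (fun M => submxrow M (Ordinal kn))).
  by rewrite mul_mxrow mxrowK submxrow0.
have VA : (V *m A <= V)%MS.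
  rewrite eq_row_base; apply/sub_kermxP.
  rewrite mul_mxrow -[RHS](mxrow0 _); apply: eq_mxrow => k.
  rewrite -mulmxA -iterS; have := ltn_ord k.
  rewrite leq_eqVlt => /orP[/eqP ->|]; last exact: VW.
  have [c ->] := Cayley_Hamilton_iter A B.
  by rewrite mulmx_sumr; apply: big1 => j _; rewrite -scalemxAr VW ?scaler0.
have [S VAS] := submxP VA.
have r0 : (0 < \rank (kermx W))%N by rewrite lt0n mxrank_eq0.
exists _, V, S; split => //; first exact: row_base_free.
exact: (VW 0%N (leq_trans r0 (rank_leq_row _))).
Qed.

Definition hautus_test n p (A : 'M[R]_n) (B : 'M[R]_(n, p)) : Prop :=
  forall (a : R[i]) v, left_eigenvector (complexify A) a v ->
    v *m complexify B != 0.

(** The real and imaginary parts of a left eigenvector for al + i be span a real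
invariant space, on which A acts by the 2 x 2 matrix S of multiplication by the
eigenvalue. *)
Lemma controllable_hautus n p (A : 'M[R]_n) (B : 'M[R]_(n, p)) :
  controllable A B -> hautus_test A B.
Proof.
move=> ctrl [al be] v [v0 vA]; apply: contraNneq v0 => vB.
have re_mul k (w : 'rV[R[i]]_n) (M : 'M[R]_(n, k)) :
    map_mx (@complex.Re R) (w *m complexify M) = map_mx (@complex.Re R) w *m M.
  apply/matrixP => i j; rewrite !mxE raddf_sum; apply: eq_bigr => l _ /=.
  by rewrite !mxE; case: (w i l) => wr wi /=; rewrite mulr0 subr0.
have im_mul k (w : 'rV[R[i]]_n) (M : 'M[R]_(n, k)) :
    map_mx (@complex.Im R) (w *m complexify M) = map_mx (@complex.Im R) w *m M.
  apply/matrixP => i j; rewrite !mxE raddf_sum; apply: eq_bigr => l _ /=.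
  by rewrite !mxE; case: (w i l) => wr wi /=; rewrite mulr0 add0r.
pose V := col_mx (map_mx (@complex.Re R) v) (map_mx (@complex.Im R) v).
pose S : 'M[R]_(1 + 1) := block_mx al%:M (- be)%:M be%:M al%:M.
have V0 : V = 0.
  apply: (@controllable_left_invariant _ _ _ _ A B _ S ctrl).
    rewrite mul_col_mx -re_mul -im_mul vA mul_block_col !mul_scalar_mx.
    by congr col_mx; apply/matrixP => i j; rewrite !mxE; case: (v i j) => wr wi /=;
      rewrite ?mulNr // addrC.
  rewrite mul_col_mx -re_mul -im_mul vB.
  by rewrite -[RHS]col_mx0; congr col_mx; apply/matrixP => i j; rewrite !mxE.
have [/matrixP vr /matrixP vi] : map_mx (@complex.Re R) v = 0 /\ map_mx (@complex.Im R) v = 0.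
  by apply: eq_col_mx; rewrite -/V V0 col_mx0.
apply/eqP/matrixP => i j.
have := vr i j; have := vi i j; rewrite !mxE; case: (v i j) => wr wi /= -> ->.
by [].
Qed.

(** If w is a left eigenvector of S, then w V is one of A, and it is annihilated by
B because V is. *)
Lemma invariant_eigenvector n p (A : 'M[R]_n) (B : 'M[R]_(n, p)) r
  (V : 'M[R]_(r, n)) (S : 'M[R]_r) :
  (0 < r)%N -> row_free V -> V *m A = S *m V -> V *m B = 0 -> ~ hautus_test A B.
Proof.
move=> r0 Vfree VA VB hautus.
have [a /eigenvalueP[w wS w0]] := eigenvalue_closed (complexify S) r0.
have := hautus a (w *m complexify V); rewrite -mulmxA -map_mxM VB map_mx0 mulmx0 eqxx.
move=> imp; suff /imp : left_eigenvector (complexify A) a (w *m complexify V) by [].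
split.
  by rewrite mulmx_free_eq0 // /complexify row_free_map.
by rewrite -mulmxA -map_mxM VA map_mxM mulmxA wS scalemxAl.
Qed.

Lemma hautus n p (A : 'M[R]_n) (B : 'M[R]_(n, p)) :
  controllable A B <-> hautus_test A B.
Proof.
split; first exact: controllable_hautus.
have [[L kalman] _|[r [V [S [r0 Vfree VA VB]]]]] := kalman_or_invariant A B.
  exact: kalman_controllable kalman.
by move=> /(invariant_eigenvector r0 Vfree VA VB).
Qed.
End Hautus.

(** * Block triangular networks *)

Section BlockRows.
Context {K : pzSemiRingType} {N : nat} {n : 'I_N -> nat}.

(** The test i == j does not identify the types of z and of the j-th block, so z
is transported by conform_mx, which is the identity for j = i. *)
Definition block_row i (z : 'rV[K]_(n i)) : 'rV[K]_(\sum_i n i) :=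
  \mxrow_j (if i == j then conform_mx 0 z else 0).

Lemma block_row_eq0 i (z : 'rV[K]_(n i)) : block_row z = 0 -> z = 0.
Proof.
move=> /(congr1 (fun v => submxrow v i)).
by rewrite mxrowK eqxx conform_mx_id submxrow0.
Qed.

Lemma mul_block_row (p : 'I_N -> nat) i (z : 'rV[K]_(n i))
    (T : forall i j, 'M[K]_(n i, p j)) :
  block_row z *m \mxblock_(i, j) T i j = \mxrow_j (z *m T i j).
Proof.
rewrite mul_mxrow_mxblock; apply: eq_mxrow => j.
rewrite (bigD1 i) //= eqxx conform_mx_id big1 ?addr0 // => k ki.
by rewrite eq_sym (negbTE ki) mul0mx.
Qed.
End BlockRows.

Lemma complexify_mxblock (R : realType) (M N : nat) (m : 'I_M -> nat) (n : 'I_N -> nat)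
    (T : forall i j, 'M[R]_(m i, n j)) :
  complexify (\mxblock_(i, j) T i j) = \mxblock_(i, j) complexify (T i j).
Proof. by apply/matrixP => i j; rewrite !mxE. Qed.

Section Network.
Context {R : realType} {N m : nat} {n p : 'I_N -> nat}.
Context (A : forall i, 'M[R]_(n i)) (B : forall i, 'M[R]_(n i, p i)).
Context (C : forall i, 'M[R]_(m, n i)) (H : forall i, 'M[R]_(n i, m)).
Context (delta : 'I_N -> bool) (beta : 'I_N -> 'I_N -> R).

Definition coupled_block i j : 'M[R]_(n i, n j) :=
  if i == j then conform_mx 0 (node_mx A C H beta i)
  else beta i j *: (H i *m C j).

Lemma network_state_mxE :
  network_state_mx A C H beta = \mxblock_(i, j) coupled_block i j.
Proof.
rewrite /network_state_mx -mxblockD; apply: eq_mxblock => i j.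
rewrite /coupled_block; case: eqVneq => [<-|_]; last by rewrite add0r.
by rewrite !conform_mx_id.
Qed.

Lemma coupled_block_diag i : coupled_block i i = node_mx A C H beta i.
Proof. by rewrite /coupled_block eqxx conform_mx_id. Qed.

Lemma coupled_block_off i j : i != j -> coupled_block i j = beta i j *: (H i *m C j).
Proof. by rewrite /coupled_block => /negbTE->. Qed.

Context (hyp_lower : forall i l : 'I_N,
   beta i l != 0 -> (l < i)%N -> H i *m C l = 0).

(** Strong induction on the block index: if all blocks of v before the i-th one
vanish, then column i of v T = a v, with T block upper triangular, reads
v_i T_ii = a v_i, so v_i would be an eigenvector that the node excludes. *)
Lemma nodes_network :
  (forall i, hautus_test (node_mx A C H beta i) ((delta i)%:R *: B i)) ->
  hautus_test (network_state_mx A C H beta) (network_input_mx B delta).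
Proof.
move=> nodes a v [v0 vA]; apply: contraNneq v0 => vB.
pose w i := submxrow v i.
have vE : v = \mxrow_i w i by rewrite submxrowK.
suff w0 i : w i = 0 by rewrite vE -(mxrow0 _); apply/eqP/eq_mxrow.
have [k] := ubnP (i : nat); elim: k i => // k IH i ik.
have wlt (j : 'I_N) : (j < i)%N -> w j = 0.
  by move=> ji; apply: IH; exact: leq_trans ji _.
apply/eqP; apply: contraT => wi0.
have wA : w i *m complexify (node_mx A C H beta i) = a *: w i.
  move: vA; rewrite network_state_mxE complexify_mxblock {1}vE mul_mxrow_mxblock.
  move=> /(congr1 (fun M => submxrow M i)); rewrite mxrowK.
  rewrite (bigD1 i) //= coupled_block_diag big1 ?addr0 => [->|j ji].
    by apply/matrixP => x y; rewrite !mxE.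
  case: (ltngtP j i) => [/wlt -> | ij | /val_inj e]; first by rewrite mul0mx.
    rewrite coupled_block_off //; have [->|/hyp_lower -> //] := eqVneq (beta j i) 0.
      by rewrite scale0r /complexify map_mx0 mulmx0.
    by rewrite scaler0 /complexify map_mx0 mulmx0.
  by rewrite e eqxx in ji.
case/negP: (nodes i a (w i) (conj wi0 wA)); apply/eqP.
move: vB; rewrite /network_input_mx /mxblockdiag complexify_mxblock {1}vE mul_mxrow_mxblock.
move=> /(congr1 (fun M => submxrow M i)); rewrite mxrowK submxrow0.
rewrite (bigD1 i) //= eqxx conform_mx_id big1 ?addr0 => [->//|j ji].
by rewrite (negbTE ji) /complexify map_mx0 mulmx0.
Qed.

Context (eigen_upper : forall (i l : 'I_N) a z,
  left_eigenvector (complexify (node_mx A C H beta i)) a z ->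
  beta i l != 0 -> (i < l)%N -> z *m complexify (H i *m C l) = 0).

(** Padding with zeros a left eigenvector of one node gives a left eigenvector of
the network, because it is annihilated by every off-diagonal block of its block
row: the lower ones are 0, the upper ones kill eigenvectors. *)
Lemma network_nodes :
  hautus_test (network_state_mx A C H beta) (network_input_mx B delta) ->
  forall i, hautus_test (node_mx A C H beta i) ((delta i)%:R *: B i).
Proof.
move=> net i a z zA; have [z0 zE] := zA.
suff vA : left_eigenvector (complexify (network_state_mx A C H beta)) a (block_row z).
  apply: contra (net a _ vA) => /eqP zB; apply/eqP.
  rewrite /network_input_mx /mxblockdiag complexify_mxblock mul_block_row.
  rewrite -(mxrow0 _); apply: eq_mxrow => j.
  case: eqVneq => [<-|_]; first by rewrite conform_mx_id.
  by rewrite /complexify map_mx0 mulmx0.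
split; first by apply: contraNneq z0 => /block_row_eq0 ->.
rewrite network_state_mxE complexify_mxblock mul_block_row.
apply/mxrowP => j; rewrite mxrowK.
have -> : submxrow (a *: block_row z) j = a *: submxrow (block_row z) j.
  by apply/matrixP => x y; rewrite !mxE.
rewrite mxrowK; case: (eqVneq i j) => [<-|ij].
  by rewrite coupled_block_diag zE conform_mx_id.
rewrite coupled_block_off // scaler0.
have [->|b0] := eqVneq (beta i j) 0.
  by rewrite scale0r /complexify map_mx0 mulmx0.
case: (ltngtP i j) => [lij | lji | /val_inj e]; last by rewrite e eqxx in ij.
  by rewrite /complexify map_mxZ -scalemxAr (eigen_upper zA) ?scaler0.
by rewrite hyp_lower // scaler0 /complexify map_mx0 mulmx0.
Qed.
End Network.

(** A free family of left eigenvectors whose size is the geometric multiplicity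
spans the eigenspace; this extends to all left eigenvectors a property known for
the given zeta. *)
Lemma eigenvector_in_free_family (F : fieldType) n g (M : 'M[F]_n) (a : F)
    (z : 'I_g -> 'rV[F]_n) (v : 'rV[F]_n) :
  g = \rank (eigenspace M a) -> (forall k, left_eigenvector M a (z k)) ->
  row_free (\matrix_k z k) -> left_eigenvector M a v ->
  (v <= \matrix_k z k)%MS.
Proof.
move=> gE zM zfree [_ vM].
have sub : (\matrix_k z k <= eigenspace M a)%MS.
  by apply/row_subP => k; rewrite rowK; apply/eigenspaceP; have [] := zM k.
apply: (@submx_trans _ _ _ _ _ _ (eigenspace M a)); first exact/eigenspaceP.
move: zfree; rewrite /row_free -(mxrank_leqif_sup sub) => /eqP->.
by rewrite gE.
Qed.

Theorem theorem4p3 (R : realType) (N m : nat) (n p : 'I_N -> nat)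
    (n_gt0 : forall i, (0 < n i)%N)
    (A : forall i, 'M[R]_(n i)) (B : forall i, 'M[R]_(n i, p i))
    (C : forall i, 'M[R]_(m, n i)) (H : forall i, 'M[R]_(n i, m))
    (delta : 'I_N -> bool) (beta : 'I_N -> 'I_N -> R)
    (q : 'I_N -> nat) (mu : forall i, 'I_(q i) -> R[i])
    (mu_inj : forall i, injective (mu i))
    (mu_spec : forall i (a : R[i]),
       eigenvalue (complexify (node_mx A C H beta i)) a
         <-> exists j, mu i j = a)
    (gamma : forall i, 'I_(q i) -> nat)
    (gammaE : forall i j,
       gamma i j =
         \rank (eigenspace (complexify (node_mx A C H beta i)) (mu i j)))
    (zeta : forall i (j : 'I_(q i)), 'I_(gamma i j) -> 'rV[R[i]]_(n i))
    (zeta_eigen : forall i j k,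
       left_eigenvector (complexify (node_mx A C H beta i)) (mu i j)
         (zeta i j k))
    (zeta_free : forall i j, row_free (\matrix_k zeta i j k))
    (hyp_lower : forall i l : 'I_N,
       beta i l != 0 -> (l < i)%N -> H i *m C l = 0)
    (hyp_upper : forall i l : 'I_N,
       beta i l != 0 -> (i < l)%N ->
       forall j k, zeta i j k *m complexify (H i *m C l) = 0) :
  controllable (network_state_mx A C H beta) (network_input_mx B delta) <->
  (forall i, controllable (node_mx A C H beta i) (B i)) /\
  (forall i, delta i).
Proof.
have eigen_upper i l a z : left_eigenvector (complexify (node_mx A C H beta i)) a z ->
    beta i l != 0 -> (i < l)%N -> z *m complexify (H i *m C l) = 0.
  move=> zA b0 il.
  have /mu_spec[j aj] : eigenvalue (complexify (node_mx A C H beta i)) a.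
    by apply/eigenvalueP; exists z; case: zA.
  rewrite -aj in zA.
  have /submxP[D ->] :=
    eigenvector_in_free_family (gammaE i j) (zeta_eigen i j) (zeta_free i j) zA.
  have ZHC : (\matrix_k zeta i j k) *m complexify (H i *m C l) = 0.
    by apply/row_matrixP => k; rewrite row_mul rowK row0 hyp_upper.
  by rewrite -mulmxA ZHC mulmx0.
rewrite hautus; split.
  move=> /(network_nodes hyp_lower eigen_upper) nodes.
  have driven i : delta i.
    have [a /eigenvalueP[z zA z0]] := eigenvalue_closed (complexify (node_mx A C H beta i)) (n_gt0 i).
    have := nodes i a z (conj z0 zA); case: (delta i) => //.
    by rewrite scale0r /complexify map_mx0 mulmx0 eqxx.
  split=> // i; apply/hautus; have := nodes i.
  by rewrite driven scale1r.
move=> [nodes driven]; apply: nodes_network => // i.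
by rewrite driven scale1r; apply/hautus.
Qed.
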